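(* Let $n \geq 1$, let $X_1,\ldots,X_n$ be independent real random variables with common distribution $\mu$ having finite variance, and let $X \sim \mu$. Let $s>0$, $\delta \in (0,1)$ and $\theta \in (0,1)$. Consider noise distribution $\rho = \text{Bernoulli}(\theta)$ (with prior $\nu = \text{Bernoulli}(1/2)$). Then the multiplicative-noise estimator $\widehat{x}_{\mathrm{M}}$ built with $\rho$ takes the form $$\widehat{x}_{\mathrm{M}} = \frac{\theta s}{n}\sum_{i=1}^{n}\psi\left(\frac{X_i}{s}\right),$$ and, with probability no less than $1-2\delta$ over the draw of the sample, $$\left|\frac{\widehat{x}_{\mathrm{M}}}{\theta} - \mathbf{E}X\right| \leq \frac{\mathbf{E}X^{2}}{2s} + \frac{s}{n\theta}\left(\theta\log(2\theta) + (1-\theta)\log(2(1-\theta)) + \log(\delta^{-1})\right).$$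
   Context: The truncation function $\psi:\mathbb{R}\to\mathbb{R}$ is $$\psi(u) = \begin{cases} u - u^{3}/6, & -\sqrt{2}\leq u\leq \sqrt{2},\\ 2\sqrt{2}/3, & u>\sqrt{2},\\ -2\sqrt{2}/3, & u<-\sqrt{2}.\end{cases}$$ Given a scale $s>0$ and noise $\epsilon_1,\ldots,\epsilon_n$ that are i.i.d. with distribution $\rho$ and independent of the data, the multiplicative-noise estimator is $$\widehat{x}_{\mathrm{M}} = \mathbf{E}_{\epsilon}\left(\frac{s}{n}\sum_{i=1}^{n}\psi\left(\frac{X_i\epsilon_i}{s}\right)\right) = \frac{s}{n}\sum_{i=1}^n \int \psi\left(\frac{X_i \epsilon}{s}\right) d\rho(\epsilon),$$ where $\mathbf{E}_\epsilon$ is expectation over the noise only, so the only remaining randomness is that of the data. $\text{Bernoulli}(\theta)$ is the distribution on $\{0,1\}$ giving mass $\theta$ to $1$. $\mathbf{E}X$ and $\mathbf{E}X^2$ are moments under $\mu$. The prior $\nu$ is an auxiliary distribution that enters neither the estimator nor the conclusion. *)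

(* Defs.v *)
From HB Require Import structures.
From mathcomp Require Import all_boot all_order all_algebra.
From mathcomp Require Import all_classical all_reals all_analysis.

Set Implicit Arguments.
Unset Strict Implicit.
Unset Printing Implicit Defensive.

Import Order.TTheory GRing.Theory Num.Theory.
Import numFieldNormedType.Exports.

Local Open Scope classical_set_scope.
Local Open Scope ring_scope.

Definition psi (R : realType) (u : R) : R :=
  if - Num.sqrt 2 <= u <= Num.sqrt 2 then u - u ^+ 3 / 6
  else if Num.sqrt 2 < u then 2 * Num.sqrt 2 / 3
  else - (2 * Num.sqrt 2 / 3).

(* Since psi is bounded and measurable, each expectation below is a finite
   number, so [fine] loses nothing. *)
Definition mult_noise_estimator (R : realType) (rho : probability R R)
    (n : nat) (s : R) (x : 'I_n -> R) : R :=
  s / n%:R * \sum_(i < n) fine 'E_rho[fun e : R => psi (x i * e / s)].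

Definition bool_to_real (R : realType) (b : bool) : R := b%:R.

Lemma measurable_bool_to_real (R : realType) :
  measurable_fun setT (@bool_to_real R).
Proof. by []. Qed.

HB.instance Definition _ (R : realType) :=
  @isMeasurableFun.Build _ _ _ _ (@bool_to_real R) (@measurable_bool_to_real R).

(* The library's Bernoulli law lives on [bool]; the noise multiplies real data,
   so it is pushed forward to {0, 1} in R. *)
Definition bernoulli_real (R : realType) (theta : R) : probability R R :=
  distribution (bernoulli_prob theta) (@bool_to_real R).

Definition mutually_independent (R : realType) (d : measure_display)
    (T : measurableType d) (P : probability T R) (n : nat)
    (X : 'I_n -> {RV P >-> R}) : Prop :=
  forall (J : {set 'I_n}) (A : 'I_n -> set R),
    (forall i, i \in J -> measurable (A i)) ->
    P (\bigcap_(i in [set` J]) (X i @^-1` A i)) =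
    (\prod_(i in J) P (X i @^-1` A i))%E.

(* Two laws are compared on measurable sets only: a library measure is a
   function on all sets, with unconstrained values on nonmeasurable ones. *)
Definition has_law (R : realType) (d : measure_display)
    (T : measurableType d) (P : probability T R) (X : {RV P >-> R})
    (mu : probability R R) : Prop :=
  forall A : set R, measurable A -> distribution P X A = mu A.

Definition finite_variance (R : realType) (mu : probability R R) : Prop :=
  mu.-integrable setT (EFin \o (@idfun R)) /\ ('V_mu[@idfun R] < +oo)%E.

(* Main.v *)
(* Since [expR (psi u) <= 1 + u + u^2/2] and [psi] is odd, the Chernoff method
   applied to the sums of [psi (X_i / s)] and of [- psi (X_i / s)] gives two-sided
   concentration with deviation [EX^2 / (2s) + (s / n) ln (1 / delta)], with
   failure probability [delta] on each side. The stated bound is weaker: its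
   entropy term is the relative entropy of Bernoulli(theta) with respect to
   Bernoulli(1/2), which is nonnegative, and [1 / theta >= 1]. Thus no
   PAC-Bayesian change of measure is needed. *)

From HB Require Import structures.
Require Import Defs.
From mathcomp Require Import all_boot all_order all_algebra.
From mathcomp Require Import all_classical all_reals all_analysis.
From mathcomp Require Import measurable_realfun ring lra.

Import Order.TTheory GRing.Theory Num.Theory.
Import numFieldNormedType.Exports.

Local Open Scope classical_set_scope.
Local Open Scope ring_scope.

(** * The exponential quadratic bound for [psi] *)

(* Exponentiating before differentiating avoids the domain of [ln]. *)
Lemma is_derive_catoni (R : realType) (u : R) :
  is_derive u 1 (fun u : R => expR (u ^+ 3 / 6 - u) * (1 + u + u ^+ 2 / 2))
    (expR (u ^+ 3 / 6 - u) * (u ^+ 3 / 2 * (1 + u / 2))).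
Proof.
apply: is_derive_eq.
rewrite /GRing.scale /=.
by field.
Qed.

(** The derivative has the sign of [u ^+ 3 * (1 + u / 2)], so on [[-2, +oo[] the function decreases
    up to [0] and increases afterwards, with minimum value [1] at [0]. *)
Lemma catoni_ge1 (R : realType) (u : R) : - 2 <= u ->
  1 <= expR (u ^+ 3 / 6 - u) * (1 + u + u ^+ 2 / 2).
Proof.
pose F (u : R) := expR (u ^+ 3 / 6 - u) * (1 + u + u ^+ 2 / 2).
rewrite -/(F u) => u2.
have dF (x : R) : is_derive x 1 F (expR (x ^+ 3 / 6 - x) * (x ^+ 3 / 2 * (1 + x / 2))).
  exact: is_derive_catoni.
have F0 : F 0 = 1.
  by rewrite /F !expr0n /= !mul0r subrr expR0 !addr0 mulr1.
have cF A : {within A, continuous F}.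
  by apply: continuous_subspaceT => x; apply: differentiable_continuous;
    apply/derivable1_diffP.
rewrite -F0; have [u0|u0] := leP 0 u.
  apply: (@ger0_derive1_ndecry _ F 0) => //.
  move=> x; rewrite in_itv/= andbT => x0.
  rewrite derive1E derive_val mulr_ge0 ?expR_ge0//.
  by rewrite mulr_ge0//; [rewrite divr_ge0// exprn_ge0// ltW | lra].
apply: (@ler0_derive1_nincr _ F (-2) 0) => //; last exact: ltW.
move=> x; rewrite in_itv/= => /andP[x2 x0].
rewrite derive1E derive_val mulr_ge0_le0 ?expR_ge0//.
rewrite mulr_le0_ge0//; last by lra.
have : 0 <= x ^+ 2 by exact: sqr_ge0.
rewrite exprS; nra.
Qed.

(** On the middle range this is [catoni_ge1] rearranged. Outside it, [psi] is frozen at the value of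
    the cubic at [r] or [- r], while the quadratic, symmetric about [-1], only grows as [u] moves
    outwards. *)
Lemma expR_psi_le (R : realType) (u : R) : expR (psi u) <= 1 + u + u ^+ 2 / 2.
Proof.
set r := Num.sqrt (2 : R).
have r2 : r ^+ 2 = 2 by rewrite sqr_sqrtr.
have r0 : 0 <= r by exact: sqrtr_ge0.
have in_range (v : R) : - 2 <= v -> expR (v - v ^+ 3 / 6) <= 1 + v + v ^+ 2 / 2.
  move=> /catoni_ge1; rewrite -[v ^+ 3 / 6 - v]opprB expRN mulrC.
  by rewrite ler_pdivlMr ?expR_gt0// mul1r.
have psir : r - r ^+ 3 / 6 = 2 * r / 3 by rewrite exprS r2; field.
rewrite /psi -/r; case: ifPn => [/andP[ur _]|].
  by apply: in_range; nra.
have [ru _|ur] := ltP r u.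
  have := in_range r; rewrite psir => /(_ ltac:(lra)) /le_trans; apply.
  nra.
rewrite andbT -ltNge => ur'.
have r1 : 1 <= r by rewrite -(@ler_pXn2r _ 2) ?nnegrE// expr1n r2; lra.
have -> : - (2 * r / 3) = - r - (- r) ^+ 3 / 6 by rewrite -psir; ring.
apply: le_trans (in_range (- r) _) _; first by nra.
(* This product is twice the increase of the quadratic from [- r] to [u]; [1 <= r] gives the sign of
   the second factor. *)
have : 0 <= (- r - u) * (r - u - 2) by apply: mulr_ge0; lra.
by rewrite sqrrN; lra.
Qed.

Lemma psiN (R : realType) (u : R) : psi (- u) = - psi u.
Proof.
have r0 : 0 < Num.sqrt (2 : R) by rewrite sqrtr_gt0.
rewrite /psi; set r := Num.sqrt (2 : R) in r0 *.
rewrite lerN2 ltrNr lerNl andbC.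
by case: (ltP u (- r)); case: (ltP r u) => /= ? ?; (lra || field).
Qed.

Lemma measurable_psi (R : realType) : measurable_fun [set: R] (@psi R).
Proof.
have m3 : measurable_fun [set: R] (fun u : R => u - u ^+ 3 / 6).
  by apply: continuous_measurable_fun => u; apply: differentiable_continuous;
    apply/derivable1_diffP.
apply: measurable_fun_ifT => //.
  by apply: measurable_and; apply: measurable_fun_ler.
by apply: measurable_fun_ifT => //; apply: measurable_fun_ltr.
Qed.

(** * Expectation of a product of functions of independent variables *)

Section integral_factorization.
Local Open Scope ereal_scope.
Context d (T : measurableType d) (R : realType) (P : probability T R).
Import HBNNSimple.

Lemma integralM_nnsfun (Y : {RV P >-> R}) (h : T -> R) (f : {nnsfun R >-> R}) :
    measurable_fun setT h -> (forall x, 0 <= h x)%R ->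
  \int[P]_x (h x * f (Y x))%:E =
  \sum_(r \in range f) r%:E * \int[P]_x (h x * \1_(f @^-1` [set r]) (Y x))%:E.
Proof.
move=> mh h0.
have mhi r : measurable_fun [set: T]
    (fun x => h x * \1_(f @^-1` [set r]) (Y x))%R.
  apply: measurable_funM => //.
  exact: (measurableT_comp (measurable_indic _)).
transitivity (\int[P]_x (\sum_(r \in range f)
    (r * (h x * \1_(f @^-1` [set r]) (Y x)))%:E)).
  apply: eq_integral => x _; rewrite fsumEFin//.
  rewrite [in LHS]fimfunE mulr_fsumr; congr (_%:E).
  by apply: eq_fsbigr => r _; rewrite mulrCA.
rewrite ge0_integral_fsum//; last 2 first.
- by move=> r; apply/measurable_EFinP/measurable_funM.
- move=> r x _; rewrite mulrCA EFinM mule_ge0// ?lee_fin//.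
  exact: nnfun_muleindic_ge0.
apply: eq_fsbigr => r; rewrite inE => -[y _ <-].
under eq_integral do rewrite EFinM.
rewrite ge0_integralZl// ?lee_fin//; first exact/measurable_EFinP.
  by move=> x _; rewrite lee_fin mulr_ge0.
Qed.

(** The factorization assumed for indicators passes to simple functions by linearity and to [g] by
    monotone convergence. Taking [A] to be the whole line shows that [c] is the integral of [h]. *)
Lemma ge0_integralM_indep (Y : {RV P >-> R}) (h g : _ -> R) (c : R) :
    measurable_fun setT h -> (forall x, 0 <= h x)%R -> (0 <= c)%R ->
    measurable_fun setT g -> (forall y, 0 <= g y)%R ->
    (forall A, measurable A ->
      \int[P]_x (h x * \1_A (Y x))%:E = c%:E * P (Y @^-1` A)) ->
  \int[P]_x (h x * g (Y x))%:E = c%:E * \int[P]_x (g (Y x))%:E.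
Proof.
move=> mh h0 c0 mg g0 hY.
have mEg : measurable_fun setT (EFin \o g) by exact/measurable_EFinP.
pose f_ := nnsfun_approx measurableT mEg.
have f_cvg y : EFin \o f_^~ y @ \oo --> (g y)%:E.
  by apply: cvg_nnsfun_approx => // z _; rewrite lee_fin.
have f_nd y : {homo (fun k => f_ k y) : a b / (a <= b)%N >-> (a <= b)%R}.
  by move=> a b ab; exact/lefP/nd_nnsfun_approx.
have limit (k : T -> R) : measurable_fun setT k -> (forall x, 0 <= k x)%R ->
    \int[P]_x (k x * g (Y x))%:E =
    limn (fun n => \int[P]_x (k x * f_ n (Y x))%:E).
  move=> mk k0; rewrite -monotone_convergence//.
  - apply: eq_integral => x _; apply/esym/cvg_lim => //.
    under eq_fun do rewrite EFinM; rewrite EFinM.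
    by apply: cvgeZl => //; exact: f_cvg.
  - by move=> n; apply/measurable_EFinP/measurable_funM => //;
      exact: measurableT_comp.
  - by move=> n x _; rewrite lee_fin mulr_ge0.
  - by move=> x _ a b ab; rewrite lee_fin ler_wpM2l// f_nd.
(* With a constant factor [1], the right-hand integral has the same shape as the left one, so
   [limit] and [integralM_nnsfun] apply to both. *)
have mul1 (k : R -> R) :
    \int[P]_x (k (Y x))%:E = \int[P]_x (cst 1%R x * k (Y x))%:E.
  by apply: eq_integral => x _; rewrite mul1r.
rewrite mul1 !limit// -limeMl//; last first.
  apply: ereal_nondecreasing_is_cvgn => a b ab; apply: ge0_le_integral => //.
  - by move=> x _; rewrite mul1r lee_fin.
  - by apply/measurable_EFinP/measurable_funM => //; exact: measurableT_comp.
  - by apply/measurable_EFinP/measurable_funM => //; exact: measurableT_comp.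
  - by move=> x _; rewrite !mul1r lee_fin f_nd.
congr (limn _); apply/funext => n /=.
rewrite !integralM_nnsfun// ge0_mule_fsumr; last first.
  move=> r; have [r0|r0] := leP 0%R r.
    by rewrite mule_ge0 ?lee_fin// integral_ge0// => x _; rewrite lee_fin mulr_ge0.
  (* A nonnegative simple function has an empty level set at a negative [r], so the term
     vanishes. *)
  by rewrite preimage_nnfun0// integral0_eq ?mule0// => x _; rewrite indic0 mulr0.
apply: eq_fsbigr => r _.
rewrite hY// muleCA -mul1; congr (_ * (_ * _)).
rewrite -[RHS]/(\int[P]_x (\1_(Y @^-1` (f_ n @^-1` [set r])) x)%:E).
rewrite integral_indic ?setIT//.
by apply: measurable_funPTI; exact: measurable_funPTI.
Qed.

(* The identity is first trivial for indicators; the coordinates listed in [r]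
   are then turned one at a time into arbitrary functions. *)
Let prod_indep n (X : 'I_n -> {RV P >-> R}) (r : seq 'I_n)
    (g : 'I_n -> R -> R) (c : 'I_n -> R) :
    mutually_independent X ->
    (forall i, measurable_fun setT (g i)) -> (forall i y, 0 <= g i y)%R ->
    (forall i, \int[P]_x (g i (X i x))%:E = (c i)%:E) ->
    (forall i, i \notin r -> exists2 A, measurable A & g i = \1_A) ->
  \int[P]_x (\prod_(i < n) g i (X i x))%:E = (\prod_(i < n) c i)%:E.
Proof.
move=> indX; elim: r g c => [|j r IH] g c mg g0 gc gI.
  have {}gI i : exists A, measurable A /\ g i = \1_A.
    by have [A mA gA] := gI i isT; exists A.
  have [A /all_and2[mA gA]] := boolp.choice gI.
  have cA i : (c i)%:E = P (X i @^-1` A i).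
    rewrite -gc gA.
    rewrite -[LHS]/(\int[P]_x (\1_(X i @^-1` A i) x)%:E).
    by rewrite integral_indic ?setIT//; exact: measurable_funPTI.
  rewrite -prodEFin.
  have := indX [set: 'I_n]%SET A (fun i _ => mA i).
  rewrite (eq_bigl xpredT) => [|i]; last by rewrite inE.
  under eq_bigr do rewrite -cA.
  move=> <-.
  rewrite -[in RHS](setIT (\bigcap_(i in _) _)) -integral_indic//; last first.
    by apply: fin_bigcap_measurable => // i _; exact: measurable_funPTI.
  apply: eq_integral => x _; congr (_%:E).
  rewrite indicE; case: (boolP (x \in _)) => [|].
    rewrite inE => xA; rewrite big1// => i _.
    by rewrite gA indicE mem_set//; apply: xA; rewrite /= inE.
  move=> /negP xA; have [/= i xi] : exists i, ~ A i (X i x).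
    by apply/existsNP => xA'; apply: xA; rewrite inE => i _; exact: xA'.
  by rewrite (bigD1 i)//= gA indicE memNset ?mul0r.
have c0 i : (0 <= c i)%R.
  by rewrite -lee_fin -gc integral_ge0// => x _; rewrite lee_fin.
have split x : (\prod_(i < n) g i (X i x) =
    (\prod_(i < n | i != j) g i (X i x)) * g j (X j x))%R.
  by rewrite (bigD1 j)//= mulrC.
under eq_integral do rewrite split.
rewrite (@ge0_integralM_indep (X j) _ _ (\prod_(i < n | i != j) c i))//.
- by rewrite gc -EFinM [in RHS](bigD1 j)//= [in RHS]mulrC.
- under eq_fun do rewrite -big_filter.
  by apply: measurable_prod => i _; exact: measurableT_comp.
- by move=> x; exact: prodr_ge0.
- exact: prodr_ge0.
move=> A mA.
(* Splitting off coordinate [j] requires the factorization for indicators of [X j] only. With [g j]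
   replaced by [\1_A], the coordinates outside [r] all carry indicators and the induction hypothesis
   applies. *)
pose g' i := if i == j then \1_A else g i.
pose c' i := if i == j then fine (P (X j @^-1` A)) else c i.
have mXA : measurable (X j @^-1` A) by exact: measurable_funPTI.
have fP : (fine (P (X j @^-1` A)))%:E = P (X j @^-1` A).
  by rewrite fineK// fin_num_measure.
transitivity (\int[P]_x (\prod_(i < n) g' i (X i x))%:E).
  apply: eq_integral => x _; congr (_%:E).
  rewrite [RHS](bigD1 j)//= /g' eqxx mulrC; congr (_ * _)%R.
  by apply: eq_bigr => i /negbTE ->.
rewrite (IH g' c').
- rewrite (bigD1 j)//= /c' eqxx mulrC EFinM fP; congr (_%:E * _).
  by apply: eq_bigr => i /negbTE ->.
- by move=> i; rewrite /g'; case: eqP => // _; exact: measurable_indic.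
- by move=> i y; rewrite /g'; case: eqP.
- move=> i; rewrite /g' /c'; case: eqP => [->|//]; rewrite fP.
  rewrite -[LHS]/(\int[P]_x (\1_(X j @^-1` A) x)%:E).
  by rewrite integral_indic ?setIT.
- move=> i ir; rewrite /g'; case: eqP => [_|/eqP ij]; first by exists A.
  by apply: gI; rewrite inE negb_or ij.
Qed.

Lemma integral_prod_indep n (X : 'I_n -> {RV P >-> R})
    (g : 'I_n -> R -> R) (c : 'I_n -> R) :
    mutually_independent X ->
    (forall i, measurable_fun setT (g i)) -> (forall i y, 0 <= g i y)%R ->
    (forall i, \int[P]_x (g i (X i x))%:E = (c i)%:E) ->
  \int[P]_x (\prod_(i < n) g i (X i x))%:E = (\prod_(i < n) c i)%:E.
Proof.
(* With every coordinate listed, the indicator condition is vacuous. *)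
move=> indX mg g0 gc; apply: (prod_indep _ _ (enum 'I_n)) => // i.
by rewrite mem_enum.
Qed.

End integral_factorization.

(** * Square integrability and the Chernoff bound *)

Lemma finite_variance_integrable_sqr (R : realType) (mu : probability R R) :
  finite_variance mu -> mu.-integrable setT (EFin \o (fun x : R => x ^+ 2)).
Proof.
move=> [intX]; rewrite /variance unlock expectation.unlock /=.
set m := fine _ => V.
have intV : mu.-integrable setT (EFin \o (fun x : R => (x - m) ^+ 2)).
  apply/integrableP; split.
    by apply/measurable_EFinP/measurable_funX; exact: measurable_funB.
  apply: le_lt_trans V; rewrite le_eqVlt; apply/orP; left; apply/eqP.
  by apply: eq_integral => x _ /=; rewrite ger0_norm ?sqr_ge0// expr2.
have intm : mu.-integrable setT (cst (m ^+ 2)%:E).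
  exact: (finite_measure_integrable_cst mu (m ^+ 2)).
apply: (@le_integrable _ _ _ mu _ measurableT _
  (fun x => (2%:E * ((x - m) ^+ 2)%:E + 2%:E * (m ^+ 2)%:E)%E)).
- exact/measurable_EFinP/measurable_funX.
- move=> x _ /=; rewrite lee_fin ger0_norm ?sqr_ge0//.
  (* The dominating function [2 (x - m)^2 + 2 m^2] exceeds [x^2] by exactly [(x - 2 m)^2]. *)
  rewrite ger0_norm; first by have := sqr_ge0 (x - 2 * m); lra.
  by rewrite addr_ge0// mulr_ge0// sqr_ge0.
- by apply: integrableD => //; exact: integrableZl.
Qed.

Section chernoff_bound.
Context (R : realType) (mu : probability R R) (alpha beta : R).
Hypothesis hvar : finite_variance mu.
Let mean := fine 'E_mu[fun x : R => x] * alpha +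
            fine 'E_mu[fun x : R => x ^+ 2] * beta.

Let integral_quadratic :
  (\int[mu]_x (1 + x * alpha + x ^+ 2 * beta)%:E = (1 + mean)%:E)%E.
Proof.
have int1 : mu.-integrable setT (fun x : R => x%:E) by case: hvar.
have int2 : mu.-integrable setT (fun x : R => (x ^+ 2)%:E).
  exact: finite_variance_integrable_sqr.
have int0 : mu.-integrable setT (EFin \o cst (1 : R)).
  exact: finite_measure_integrable_cst.
have int1a := integrableZl measurableT alpha int1.
have int2b := integrableZl measurableT beta int2.
under eq_integral do rewrite !EFinD ![(_ * alpha)%R]mulrC ![(_ * beta)%R]mulrC !EFinM.
rewrite integralD//; last exact: integrableD.
rewrite integralD// !integralZl//.
have -> : (\int[mu]_x 1%:E = 1)%E.
  by rewrite integral_cst// mul1e; exact: probability_setT.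
rewrite /mean !EFinD !EFinM addeA [(_ * alpha%:E)%E]muleC [(_ * beta%:E)%E]muleC.
by rewrite unlock !fineK//; exact: integrable_fin_num.
Qed.

(** By independence the exponential moment of the sum is the [n]-th power of [I], and
    [I <= 1 + mean <= expR mean]. Keeping [alpha] and [beta] free lets one bound serve both [psi]
    and [- psi], whose linear coefficients have opposite signs. *)
Lemma chernoff_quadratic d (T : measurableType d) (P : probability T R)
    (n : nat) (X : 'I_n -> {RV P >-> R}) (f : R -> R) (delta : R) :
    mutually_independent X -> (forall i, has_law (X i) mu) ->
    measurable_fun setT f ->
    (forall x, expR (f x) <= 1 + x * alpha + x ^+ 2 * beta) -> 0 < delta ->
  (P [set w | n%:R * mean + ln delta^-1 <= \sum_(i < n) f (X i w)]%R
    <= delta%:E)%E.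
Proof.
move=> indX lawX mf f_le delta0.
have mef : measurable_fun setT (expR \o f) by exact: measurableT_comp.
have mS : measurable_fun [set: T] (fun w => \sum_(i < n) f (X i w)).
  by apply: measurable_sum => i; exact: (measurableT_comp mf).
pose S : {mfun T >-> R} := HB.pack (fun w => \sum_(i < n) f (X i w))
  (isMeasurableFun.Build _ _ _ _ _ mS).
pose I := (\int[mu]_x (expR (f x))%:E)%E.
have I_le : (I <= (expR mean)%:E)%E.
  apply: (@le_trans _ _ (1 + mean)%:E); last by rewrite lee_fin expR_ge1Dx.
  rewrite -integral_quadratic; apply: ge0_le_integral => //.
  - exact/measurable_EFinP.
  - by apply/measurable_EFinP; do ?apply: measurable_funD => //;
      apply: measurable_funM => //; exact: measurable_funX.
  - by move=> x _; rewrite lee_fin.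
have I0 : (0 <= I)%E by apply: integral_ge0 => x _; rewrite lee_fin expR_ge0.
have IK : (fine I)%:E = I.
  by rewrite fineK// ge0_fin_numE// (le_lt_trans I_le) ?ltry.
have IX i : (\int[P]_w (expR (f (X i w)))%:E = (fine I)%:E)%E.
  rewrite IK /I -(@eq_measure_integral _ _ _ setT _ (distribution P (X i))).
    rewrite ge0_integral_distribution//; first exact/measurable_EFinP.
  by move=> A mA _; exact: lawX.
have mgf : ('M_P S 1 <= (expR (n%:R * mean))%:E)%E.
  rewrite /mmt_gen_fun unlock.
  under eq_integral => w _ do rewrite /= mulr1 expR_sum.
  rewrite (integral_prod_indep _ _ _ P n X (fun=> expR \o f) (fun=> fine I))//.
    rewrite lee_fin prodr_const card_ord expRM_natl.
    by rewrite lerXn2r ?nnegrE ?fine_ge0 ?expR_ge0// -lee_fin IK.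
  by move=> i y; exact: expR_ge0.
(* Parameter [1] suffices, any scaling being part of [f]; the threshold is chosen so that the
   exponents cancel and leave exactly [delta]. *)
apply: (le_trans (chernoff S _ ltr01)).
apply: (@le_trans _ _ ((expR (n%:R * mean))%:E *
    (expR (- (1 * (n%:R * mean + ln delta^-1))))%:E)%E).
  by rewrite lee_wpmul2r// lee_fin expR_ge0.
by rewrite -EFinM -expRD mul1r opprD addrA subrr add0r lnV ?posrE// opprK lnK ?posrE//.
Qed.

End chernoff_bound.

(** * Closed form of the estimator and sign of the entropy term *)

(** Noise [0] contributes [psi 0 = 0], and noise [1] contributes [psi (x i / s)] with weight
    [theta]. *)
Lemma mult_noise_estimator_bernoulli (R : realType) (n : nat) (s theta : R)
    (x : 'I_n -> R) : 0 <= theta <= 1 ->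
  mult_noise_estimator (bernoulli_real theta) s x =
  theta * s / n%:R * \sum_(i < n) psi (x i / s).
Proof.
move=> theta01; rewrite /mult_noise_estimator.
have psi0 : psi 0 = 0 :> R.
  by rewrite /psi expr0n /= mul0r subrr oppr_le0 sqrtr_ge0.
(* Since [psi 0 = 0], the integrand is a constant multiple of [b], so its integrability reduces to
   that of [b]. *)
pose b (y : bool) : \bar R := (y%:R)%:E.
have b0 y : (0 <= b y)%E by rewrite lee_fin.
have intb : (bernoulli_prob theta).-integrable setT b.
  apply/integrableP; split=> //.
  under eq_integral => y _ do rewrite gee0_abs//.
  by rewrite integral_bernoulli_prob// /b -!EFinM -EFinD ltry.
have E i : fine 'E_(bernoulli_real theta)[fun e => psi (x i * e / s)] =
    theta * psi (x i / s).
  have bE y : (psi (x i * bool_to_real R y / s))%:E = ((psi (x i / s))%:E * b y)%E.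
    by case: y; rewrite /b /bool_to_real /= -EFinM ?mulr1 ?mulr0 ?mul0r ?psi0.
  rewrite unlock integral_distribution//=.
  - under eq_integral do rewrite bE.
    rewrite integralZl// integral_bernoulli_prob//.
    have -> : b true = 1%E by [].
    have -> : b false = 0%E by [].
    by rewrite mule1 mule0 adde0 -EFinM mulrC.
  - apply/measurable_EFinP; apply: (measurableT_comp (measurable_psi R)).
    by apply: measurable_funM => //; exact: measurable_funM.
  - rewrite (_ : _ \o _ = fun y => ((psi (x i / s))%:E * b y)%E).
      exact: integrableZl.
    by apply/funext => y; exact: bE.
rewrite (eq_bigr _ (fun i _ => E i)) -mulr_sumr mulrA; congr (_ * _).
by rewrite mulrC mulrA.
Qed.

(** Applying [ln x <= x - 1] at [x = (2 * p)^-1] gives [p - 2^-1 <= p * ln (2 * p)]; the lower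
    bounds for [theta] and [1 - theta] sum to zero. *)
Lemma kl_bernoulli_half_ge0 (R : realType) (theta : R) : 0 < theta < 1 ->
  0 <= theta * ln (2 * theta) + (1 - theta) * ln (2 * (1 - theta)).
Proof.
have lnge (p : R) : 0 < p -> p - 2^-1 <= p * ln (2 * p).
  move=> p0; have p20 : 0 < (2 * p)^-1 by rewrite invr_gt0 mulr_gt0.
  have := @le_ln1Dx R ((2 * p)^-1 - 1).
  rewrite [1 + _]addrC subrK lnV ?posrE ?mulr_gt0// => /(_ ltac:(lra)) ln_le.
  apply: (@le_trans _ _ (p * (1 - (2 * p)^-1))); last first.
    by rewrite ler_pM2l//; lra.
  by rewrite le_eqVlt; apply/orP; left; apply/eqP; field; lra.
move=> /andP[t0 t1].
have := lnge theta t0.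
have := lnge (1 - theta) ltac:(lra).
lra.
Qed.

(** * The two-sided deviation bound *)

Theorem proposition2 (R : realType) (d : measure_display)
  (T : measurableType d) (P : probability T R) (n : nat)
  (X : 'I_n -> {RV P >-> R}) (mu : probability R R) (s delta theta : R)
  (hn : (1 <= n)%N)
  (hind : mutually_independent X)
  (hlaw : forall i, has_law (X i) mu)
  (hvar : finite_variance mu)
  (hs : 0 < s)
  (hdelta : 0 < delta < 1)
  (htheta : 0 < theta < 1) :
  let xM (w : T) :=
    mult_noise_estimator (bernoulli_real theta) s (fun i => X i w) in
  let EX := fine 'E_mu[fun x : R => x] in
  let EX2 := fine 'E_mu[fun x : R => x ^+ 2] in
  let bound := EX2 / (2 * s) +
    s / (n%:R * theta) *
      (theta * ln (2 * theta) + (1 - theta) * ln (2 * (1 - theta))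
       + ln (delta^-1)) in
  (forall w : T, xM w = theta * s / n%:R * \sum_(i < n) psi (X i w / s)) /\
  (P [set w | (`|xM w / theta - EX| <= bound)%R] >= (1 - 2 * delta)%:E)%E.
Proof.
move=> xM EX EX2 bound.
have [delta0 delta1] := andP hdelta; have [theta0 theta1] := andP htheta.
have xME w : xM w = theta * s / n%:R * \sum_(i < n) psi (X i w / s).
  by apply: mult_noise_estimator_bernoulli; rewrite !ltW.
split=> //.
set L := ln delta^-1 in bound *.
have L0 : 0 <= L by rewrite ln_ge0// invf_ge1// ltW.
have n0 : 0 < n%:R :> R by rewrite ltr0n.
pose Z (w : T) := \sum_(i < n) psi (X i w / s).
have mpsi : measurable_fun [set: R] (fun x : R => psi (x / s)).
  apply: (measurableT_comp (measurable_psi R)).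
  exact: measurable_funM.
have mZ : measurable_fun [set: T] Z.
  by apply: measurable_sum => i; exact: (measurableT_comp mpsi).
(* The coefficient of [x ^+ 2] in the quadratic bound evaluated at [x / s]. *)
pose b := (2 * s ^+ 2)^-1.
(* [U] and [V] are the events that the estimate is too large or too small. Outside both, the two
   strict inequalities yield the claim, and a union bound gives the failure probability
   [2 * delta]. *)
pose U := [set w | n%:R * (EX * s^-1 + EX2 * b) + L <= Z w].
pose V := [set w | n%:R * (EX * - s^-1 + EX2 * b) + L <= - Z w].
have PU : (P U <= delta%:E)%E.
  apply: (chernoff_quadratic _ mu _ _ hvar _ T P n X (fun x => psi (x / s))) => //.
  move=> x; apply: (le_trans (expR_psi_le _ _)).
  by rewrite le_eqVlt; apply/orP; left; apply/eqP; rewrite /b; field; lra.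
have PV : (P V <= delta%:E)%E.
  have -> : V = [set w | n%:R * (EX * - s^-1 + EX2 * b) + L <=
      \sum_(i < n) - psi (X i w / s)] by rewrite /V /Z; under eq_set do rewrite -sumrN.
  apply: (chernoff_quadratic _ mu _ _ hvar _ T P n X (fun x => - psi (x / s))) => //.
    exact: measurable_funN.
  move=> x; rewrite -psiN; apply: (le_trans (expR_psi_le _ _)).
  by rewrite le_eqVlt; apply/orP; left; apply/eqP; rewrite /b; field; lra.
have mle (c : R) (f : T -> R) : measurable_fun [set: T] f ->
    measurable [set w | c <= f w].
  move=> mf; rewrite -[X in measurable X]setTI.
  rewrite (_ : [set w | _] = f @^-1` `[c, +oo[).
    exact: mf.
  by apply/seteqP; split=> w /=; rewrite in_itv/= andbT.
have mU : measurable U by exact: mle.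
have mV : measurable V by apply: mle; exact: measurable_funN.
apply: (@le_trans _ _ (P (~` (U `|` V)))).
  rewrite probability_setC; last exact: measurableU.
  rewrite EFinB leeB//; apply: (le_trans (measureU2 _ mU mV)).
  by rewrite mulr_natl mulr2n EFinD leeD.
apply: le_measure; rewrite ?inE.
- exact/measurableC/measurableU.
(* Negating both sides turns the upper bound into a lower one, the form that [mle] handles. *)
- rewrite [X in measurable X](_ : _ = [set w | - bound <= - `|xM w / theta - EX|]).
    apply: mle; apply: measurable_funN; apply: measurableT_comp => //.
    apply: measurable_funB => //; apply: measurable_funM => //.
    by rewrite (funext xME); exact: measurable_funM.
  by apply: eq_set => w; rewrite lerN2.
move=> w; rewrite setCU => -[/negP + /negP]; rewrite -!ltNge => Uw Vw /=.
have -> : xM w / theta = s / n%:R * Z w by rewrite xME /Z; field; lra.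
(* The stated bound is weaker than the one obtained: [theta < 1] enlarges the factor of [L], and the
   entropy term is nonnegative. *)
have LB : s / n%:R * L <= bound - EX2 / (2 * s).
  rewrite /bound [X in X - _]addrC addrK.
  apply: (@le_trans _ _ (s / (n%:R * theta) * L)).
    rewrite ler_wpM2r// ler_pM2l// lef_pV2 ?posrE ?mulr_gt0//.
    by rewrite ger_pMr// ltW.
  rewrite ler_pM2l ?divr_gt0 ?mulr_gt0//.
  by have := kl_bernoulli_half_ge0 _ _ htheta; lra.
have sn0 : 0 < s / n%:R by rewrite divr_gt0.
rewrite -(ltr_pM2l sn0) in Uw; rewrite -(ltr_pM2l sn0) in Vw.
(* Multiplying by [s / n%:R] turns the thresholds for [Z] and [- Z] into deviations around [EX]. *)
have EU : s / n%:R * (n%:R * (EX * s^-1 + EX2 * b) + L) =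
    EX + EX2 / (2 * s) + s / n%:R * L by rewrite /b; field; lra.
have EV : s / n%:R * (n%:R * (EX * - s^-1 + EX2 * b) + L) =
    - EX + EX2 / (2 * s) + s / n%:R * L by rewrite /b; field; lra.
rewrite EU in Uw; rewrite EV mulrN in Vw.
by rewrite ler_norml; apply/andP; split; lra.
Qed.
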